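(* Let $(H,\Phi,\mathcal{R},\chi)$ be a pre-Cartier quasi-bialgebra and consider the following elements of $H^{\otimes 3}$: $$\Theta^{12}=\chi_{12},\qquad \Theta^{23}=\Phi^{-1}\chi_{23}\Phi,\qquad \Theta^{13}=\Phi^{-1}\mathcal{R}_{23}^{-1}\Phi_{132}\,\chi_{13}\,\Phi_{132}^{-1}\mathcal{R}_{23}\Phi,$$ $$\Upsilon^{12}=\Phi\chi_{12}\Phi^{-1},\qquad \Upsilon^{23}=\chi_{23},\qquad \Upsilon^{13}=\Phi\mathcal{R}_{12}^{-1}\Phi_{213}^{-1}\,\chi_{13}\,\Phi_{213}\mathcal{R}_{12}\Phi^{-1}.$$ Then each of the two families $A=\Theta$ and $A=\Upsilon$ (with $A^{ji}:=A^{ij}$) satisfies the infinitesimal braid relations $$[A^{ij},A^{ik}+A^{jk}]=0\qquad\text{whenever }\{i,j,k\}=\{1,2,3\}.$$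
   Context: $\Bbbk$ is a field of characteristic zero; all algebras are associative unital $\Bbbk$-algebras, all maps are $\Bbbk$-linear, $\otimes=\otimes_\Bbbk$, $\tau$ is the tensor flip, and $[\cdot,\cdot]$ is the commutator. Leg notation: for $A=\sum A^1\otimes A^2\in H\otimes H$, put $A^{\mathrm{op}}=\tau(A)$, $A_{12}=A\otimes 1$, $A_{23}=1\otimes A$, $A_{13}=\sum A^1\otimes 1\otimes A^2$. For $\Phi=\sum\Phi^1\otimes\Phi^2\otimes\Phi^3\in H^{\otimes 3}$ and a permutation $(i,j,k)$ of $(1,2,3)$, put $\Phi_{ijk}=\sum\Phi^i\otimes\Phi^j\otimes\Phi^k$. A quasi-bialgebra is an algebra $H$ with algebra morphisms $\Delta\colon H\to H\otimes H$, $\varepsilon\colon H\to\Bbbk$ and invertible elements $\Phi\in H^{\otimes 3}$, $\ell,r\in H$ such that for all $h\in H$: $(\mathrm{id}\otimes\Delta)\Delta(h)=\Phi\,(\Delta\otimes\mathrm{id})\Delta(h)\,\Phi^{-1}$, $(\varepsilon\otimes\mathrm{id})\Delta(h)=\ell^{-1}h\ell$, $(\mathrm{id}\otimes\varepsilon)\Delta(h)=r^{-1}hr$, and $(\mathrm{id}\otimes\mathrm{id}\otimes\Delta)(\Phi)(\Delta\otimes\mathrm{id}\otimes\mathrm{id})(\Phi)=(1\otimes\Phi)(\mathrm{id}\otimes\Delta\otimes\mathrm{id})(\Phi)(\Phi\otimes 1)$, $(\mathrm{id}\otimes\varepsilon\otimes\mathrm{id})(\Phi)=r\otimes\ell^{-1}$.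 It is quasitriangular if it is endowed with an invertible $\mathcal{R}\in H\otimes H$ with $\Delta^{\mathrm{op}}(\cdot)=\mathcal{R}\Delta(\cdot)\mathcal{R}^{-1}$, $(\mathrm{id}\otimes\Delta)(\mathcal{R})=\Phi_{312}^{-1}\mathcal{R}_{13}\Phi_{213}\mathcal{R}_{12}\Phi^{-1}$, $(\Delta\otimes\mathrm{id})(\mathcal{R})=\Phi_{231}\mathcal{R}_{13}\Phi_{132}^{-1}\mathcal{R}_{23}\Phi$. A pre-Cartier quasi-bialgebra is a quasitriangular quasi-bialgebra together with an element $\chi\in H\otimes H$ (infinitesimal $\mathcal{R}$-matrix) with $\chi\Delta(\cdot)=\Delta(\cdot)\chi$, $(\mathrm{id}\otimes\Delta)(\chi)=\Phi\mathcal{R}_{12}^{-1}\Phi_{213}^{-1}\chi_{13}\Phi_{213}\mathcal{R}_{12}\Phi^{-1}+\Phi\chi_{12}\Phi^{-1}$, $(\Delta\otimes\mathrm{id})(\chi)=\Phi^{-1}\mathcal{R}_{23}^{-1}\Phi_{132}\chi_{13}\Phi_{132}^{-1}\mathcal{R}_{23}\Phi+\Phi^{-1}\chi_{23}\Phi$. *)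

(* Defs.v *)
From HB Require Import structures.
From mathcomp Require Import all_boot all_order all_algebra.
From mathcomp Require boolp classical_sets.

Set Implicit Arguments.
Unset Strict Implicit.
Unset Printing Implicit Defensive.

Import GRing.Theory.
Local Open Scope ring_scope.
Local Open Scope quotient_scope.

Reserved Notation "U ⊗ V" (at level 38, left associativity).

(** A tensor is a class of finite formal sums [:: (u_1, v_1); ...; (u_n, v_n)],
    standing for u_1 ⊗ v_1 + ... + u_n ⊗ v_n, modulo the least congruence that
    makes ⊗ bilinear and the sum commutative.  The universal property is given
    by [tlift_tens], [tlift_linear] and [tensor_ind] below. *)
Section TensorSpace.
Variables (k : fieldType) (U V : lmodType k).
Implicit Types (s t : seq (U * V)).

Inductive tensor_eq : seq (U * V) -> seq (U * V) -> Prop :=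
| TeqRefl s : tensor_eq s s
| TeqSym s t : tensor_eq s t -> tensor_eq t s
| TeqTrans s t w : tensor_eq s t -> tensor_eq t w -> tensor_eq s w
| TeqCat s s' t t' :
    tensor_eq s s' -> tensor_eq t t' -> tensor_eq (s ++ t) (s' ++ t')
| TeqC s t : tensor_eq (s ++ t) (t ++ s)
| Teq0 v : tensor_eq [:: (0, v)] [::]
| TeqDl u u' v : tensor_eq [:: (u + u', v)] [:: (u, v); (u', v)]
| TeqDr u v v' : tensor_eq [:: (u, v + v')] [:: (u, v); (u, v')]
| TeqZ a u v : tensor_eq [:: (a *: u, v)] [:: (u, a *: v)].

Definition tensor_eqb s t : bool := boolp.asbool (tensor_eq s t).

Lemma tensor_eqbP s t : reflect (tensor_eq s t) (tensor_eqb s t).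
Proof. exact: boolp.asboolP. Qed.

Fact tensor_eqb_refl : reflexive tensor_eqb.
Proof. by move=> s; apply/tensor_eqbP; constructor. Qed.

Fact tensor_eqb_sym : symmetric tensor_eqb.
Proof.
by move=> s t; apply/idP/idP => /tensor_eqbP st; apply/tensor_eqbP/TeqSym.
Qed.

Fact tensor_eqb_trans : transitive tensor_eqb.
Proof.
move=> t s w /tensor_eqbP st /tensor_eqbP tw.
by apply/tensor_eqbP; apply: TeqTrans tw.
Qed.

Canonical tensor_equiv :=
  EquivRel tensor_eqb tensor_eqb_refl tensor_eqb_sym tensor_eqb_trans.

Definition tensor := {eq_quot tensor_eqb}.

HB.instance Definition _ : EqQuotient _ tensor_eqb tensor :=
  EqQuotient.on tensor.
HB.instance Definition _ := Choice.on tensor.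

Lemma tensor_piP s t : \pi_tensor s = \pi_tensor t <-> tensor_eq s t.
Proof. by split=> [/eqmodP/tensor_eqbP|st] //; apply/eqmodP/tensor_eqbP. Qed.

Lemma tensor_reprP s : tensor_eq (repr (\pi_tensor s)) s.
Proof. by apply/tensor_piP; rewrite reprK. Qed.

Definition tensor_zero : tensor := \pi_tensor [::].
Definition tensor_add (x y : tensor) : tensor := \pi_tensor (repr x ++ repr y).
Definition tensor_scale (a : k) (x : tensor) : tensor :=
  \pi_tensor [seq (a *: p.1, p.2) | p <- repr x].
Definition tensor_opp (x : tensor) : tensor := tensor_scale (-1) x.

Fact tensor_add_pi s t :
  tensor_add (\pi_tensor s) (\pi_tensor t) = \pi_tensor (s ++ t).
Proof. by apply/tensor_piP; apply: TeqCat; apply: tensor_reprP. Qed.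

Fact tensor_scale_pi a s :
  tensor_scale a (\pi_tensor s) = \pi_tensor [seq (a *: p.1, p.2) | p <- s].
Proof.
apply/tensor_piP; move: (repr _) (tensor_reprP s) => t; elim=> {s t}.
- by move=> s; apply: TeqRefl.
- by move=> s t _; apply: TeqSym.
- by move=> s t w _ st _; apply: TeqTrans.
- by move=> s s' t t' _ Hs _ Ht; rewrite !map_cat; apply: TeqCat.
- by move=> s t; rewrite !map_cat; apply: TeqC.
- by move=> v /=; rewrite scaler0; apply: Teq0.
- by move=> u u' v /=; rewrite scalerDr; apply: TeqDl.
- by move=> u v v' /=; apply: TeqDr.
- by move=> b u v /=; rewrite scalerA mulrC -scalerA; apply: TeqZ.
Qed.

Fact tensor_addA : associative tensor_add.
Proof.
move=> x y z; elim/quotW: x => s; elim/quotW: y => t; elim/quotW: z => w.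
by rewrite (tensor_add_pi s t) (tensor_add_pi t w) !tensor_add_pi catA.
Qed.

Fact tensor_addC : commutative tensor_add.
Proof.
move=> x y; elim/quotW: x => s; elim/quotW: y => t; rewrite !tensor_add_pi.
by apply/tensor_piP/TeqC.
Qed.

Fact tensor_add0 : left_id tensor_zero tensor_add.
Proof. by move=> x; elim/quotW: x => s; rewrite tensor_add_pi. Qed.

Fact tensor_scaleDl x a b :
  tensor_scale (a + b) x = tensor_add (tensor_scale a x) (tensor_scale b x).
Proof.
elim/quotW: x => s; rewrite !tensor_scale_pi tensor_add_pi.
elim: s => [|[u v] s IHs] //=.
rewrite -cat1s -[in RHS]cat1s -[(b *: u, v) :: _]cat1s -tensor_add_pi {}IHs.
rewrite -!tensor_add_pi scalerDl.
have -> : \pi_tensor [:: (a *: u + b *: u, v)] =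
  tensor_add (\pi_tensor [:: (a *: u, v)]) (\pi_tensor [:: (b *: u, v)]).
  by rewrite tensor_add_pi; apply/tensor_piP/TeqDl.
rewrite -!tensor_addA; congr tensor_add; rewrite !tensor_addA.
by congr tensor_add; rewrite tensor_addC.
Qed.

Fact tensor_scale0 x : tensor_scale 0 x = tensor_zero.
Proof.
elim/quotW: x => s; rewrite tensor_scale_pi.
elim: s => [|[u v] s IHs] //=.
rewrite -cat1s -tensor_add_pi {}IHs scale0r -[RHS]tensor_add0.
by congr tensor_add; apply/tensor_piP/Teq0.
Qed.

Fact tensor_scale1 : left_id 1 tensor_scale.
Proof.
move=> x; elim/quotW: x => s; rewrite tensor_scale_pi; congr (\pi_tensor _).
by elim: s => [|[u v] s IHs] //=; rewrite IHs scale1r.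
Qed.

Fact tensor_addN : left_inverse tensor_zero tensor_opp tensor_add.
Proof.
move=> x; rewrite -{2}[x]tensor_scale1 -tensor_scaleDl addNr.
exact: tensor_scale0.
Qed.

Fact tensor_scaleA a b x :
  tensor_scale a (tensor_scale b x) = tensor_scale (a * b) x.
Proof.
elim/quotW: x => s; rewrite (tensor_scale_pi b s) !tensor_scale_pi -map_comp; congr (\pi_tensor _).
by apply: eq_map => p /=; rewrite scalerA.
Qed.

Fact tensor_scaleDr : right_distributive tensor_scale tensor_add.
Proof.
move=> a x y; elim/quotW: x => s; elim/quotW: y => t.
by rewrite (tensor_add_pi s t) !tensor_scale_pi tensor_add_pi map_cat.
Qed.

HB.instance Definition _ := GRing.isZmodule.Build tensor
  tensor_addA tensor_addC tensor_add0 tensor_addN.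

HB.instance Definition _ := GRing.Zmodule_isLmodule.Build k tensor
  tensor_scaleA tensor_scale1 tensor_scaleDr
  (fun x a b => tensor_scaleDl x a b).

Definition tens (u : U) (v : V) : tensor := \pi_tensor [:: (u, v)].

Lemma tens_bilinear : bilinear_for *:%R *:%R tens.
Proof.
have Zl a u v : tens (a *: u) v = a *: tens u v.
  by rewrite [RHS]tensor_scale_pi.
split=> [v a u u' | u a v v'] /=; rewrite -Zl [RHS]tensor_add_pi.
  exact/tensor_piP/TeqDl.
apply/tensor_piP; apply: TeqTrans (TeqDr _ _ _) _.
by apply: (@TeqCat [:: _] [:: _]); [apply/TeqSym/TeqZ | apply: TeqRefl].
Qed.

HB.instance Definition _ := bilinear_isBilinear.Build k U V tensor *:%R *:%R
  tens tens_bilinear.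

Lemma tensor_ind (P : tensor -> Prop) :
  P 0 -> (forall u v, P (tens u v)) -> (forall x y, P x -> P y -> P (x + y)) ->
  forall x, P x.
Proof.
move=> P0 Pt PD x; elim/quotW: x => s; elim: s => [|[u v] s IHs] //.
have -> : \pi_tensor ((u, v) :: s) = tens u v + \pi_tensor s.
  by rewrite [RHS]tensor_add_pi.
exact: PD.
Qed.

(** The linear map induced by f, well defined when f is bilinear; see
    [tlift_tens] and [tlift_linear]. *)
Definition tlift (W : lmodType k) (f : U -> V -> W) (x : tensor) : W :=
  \sum_(p <- repr x) f p.1 p.2.

Section Lift.
Variables (W : lmodType k) (f : U -> V -> W).
Hypothesis bilf : bilinear_for *:%R *:%R f.

Let fDl v u u' : f (u + u') v = f u v + f u' v.
Proof. by have := bilf.1 v 1 u u'; rewrite /= !scale1r. Qed.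
Let fDr u v v' : f u (v + v') = f u v + f u v'.
Proof. by have := bilf.2 u 1 v v'; rewrite /= !scale1r. Qed.
Let f0l v : f 0 v = 0.
Proof. by apply: (@addrI _ (f 0 v)); rewrite -fDl !addr0. Qed.
Let f0r u : f u 0 = 0.
Proof. by apply: (@addrI _ (f u 0)); rewrite -fDr !addr0. Qed.
Let fZl a u v : f (a *: u) v = a *: f u v.
Proof. by have := bilf.1 v a u 0; rewrite /= !addr0 f0l addr0. Qed.
Let fZr a u v : f u (a *: v) = a *: f u v.
Proof. by have := bilf.2 u a v 0; rewrite /= !addr0 f0r addr0. Qed.

Lemma tlift_pi s : tlift f (\pi_tensor s) = \sum_(p <- s) f p.1 p.2.
Proof.
rewrite /tlift; move: (repr _) (tensor_reprP s) => t; elim=> {s t} //=.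
- by move=> s t w _ -> _ ->.
- by move=> s s' t t' _ Hs _ Ht; rewrite !big_cat /= Hs Ht.
- by move=> s t; rewrite !big_cat /= addrC.
- by move=> v; rewrite big_seq1 big_nil f0l.
- by move=> u u' v; rewrite !big_cons !big_nil /= fDl addrA.
- by move=> u v v'; rewrite !big_cons !big_nil /= fDr addrA.
- by move=> a u v; rewrite !big_seq1 /= fZl fZr.
Qed.

Lemma tlift_tens u v : tlift f (tens u v) = f u v.
Proof. by rewrite tlift_pi big_seq1. Qed.

Lemma tlift_linear : linear (tlift f).
Proof.
move=> a x y; elim/quotW: x => s; elim/quotW: y => t.
have -> : a *: \pi_tensor s + \pi_tensor t =
    \pi_tensor ([seq (a *: p.1, p.2) | p <- s] ++ t).
  by rewrite -tensor_add_pi -tensor_scale_pi.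
rewrite !tlift_pi big_cat big_map scaler_sumr; congr (_ + _).
by apply: eq_bigr => p _; rewrite fZl.
Qed.

End Lift.
End TensorSpace.

Arguments tensor {k}%_type_scope U V.
Arguments tens {k U V} u v.
Arguments tlift {k U V W} f x.

Notation "U ⊗ V" := (tensor U%type V%type) : type_scope.
Notation "u ⊗ v" := (tens u v) : ring_scope.

Section TensorTheory.
Variables (k : fieldType).
Implicit Types (U V W : lmodType k).

Lemma tensPl U V a (u u' : U) (v : V) :
  (a *: u + u') ⊗ v = a *: (u ⊗ v) + u' ⊗ v.
Proof. exact: (tens_bilinear U V).1. Qed.

Lemma tensPr U V a (u : U) (v v' : V) :
  u ⊗ (a *: v + v') = a *: (u ⊗ v) + u ⊗ v'.
Proof. exact: (tens_bilinear U V).2. Qed.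

Lemma eq_tlift U V W (f g : U -> V -> W) : f =2 g -> tlift f =1 tlift g.
Proof. by move=> fg x; apply: eq_bigr => p _; rewrite fg. Qed.

Lemma tliftP U V W a (f g : U -> V -> W) x :
  tlift (fun u v => a *: f u v + g u v) x = a *: tlift f x + tlift g x.
Proof. by rewrite /tlift big_split scaler_sumr. Qed.

Lemma linearI U W (f : U -> W) : linear f ->
  (forall x y, f (x + y) = f x + f y) /\ f 0 = 0.
Proof.
move=> lf; have fD x y : f (x + y) = f x + f y.
  by rewrite -[x in LHS]scale1r lf scale1r.
by split=> //; apply: (@addrI _ (f 0)); rewrite -fD !addr0.
Qed.

Lemma tens0l U V (v : V) : (0 : U) ⊗ v = 0.
Proof. exact: (linearI ((tens_bilinear U V).1 v)).2. Qed.

Lemma tens0r U V (u : U) : u ⊗ (0 : V) = 0.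
Proof. exact: (linearI ((tens_bilinear U V).2 u)).2. Qed.

Lemma tensDl U V (u u' : U) (v : V) : (u + u') ⊗ v = u ⊗ v + u' ⊗ v.
Proof. exact: (linearI ((tens_bilinear U V).1 v)).1. Qed.

Lemma tensDr U V (u : U) (v v' : V) : u ⊗ (v + v') = u ⊗ v + u ⊗ v'.
Proof. exact: (linearI ((tens_bilinear U V).2 u)).1. Qed.

Lemma tensor_ext U V W (f g : U ⊗ V -> W) : linear f -> linear g ->
  (forall u v, f (u ⊗ v) = g (u ⊗ v)) -> f =1 g.
Proof.
move=> /linearI[fD f0] /linearI[gD g0] fg; elim/tensor_ind => [|//|x y fx fy].
  by rewrite f0 g0.
by rewrite fD gD fx fy.
Qed.

Lemma linear_separation U (u : U) : u != 0 ->
  exists2 f : U -> k^o, linear f & f u = 1.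
Proof.
move=> u0.
pose sub (X : U -> Prop) := forall a x y, X x -> X y -> X (a *: x + y).
pose P (X : U -> Prop) := sub X /\ ~ X u.
have [F FP Ftot|X [[subX Xu] maxX]] := @classical_sets.Zorn_bigcup U P.
  split=> [a x y [Y FY Yx] [Z FZ Zy]|[Y FY Yu]]; last by have [_] := FP _ FY.
  have [YZ|ZY] := Ftot _ _ FY FZ.
    by exists Z => //; have [+ _] := FP _ FZ; apply => //; apply: YZ.
  by exists Y => //; have [+ _] := FP _ FY; apply => //; apply: ZY.
have X0 : X 0.
  apply: boolp.contrapT => nX0; pose Y x := X x \/ x = 0.
  have noX x : ~ X x by move=> Xx; apply: nX0; rewrite -(addNr x) -scaleN1r; apply: subX.
  have [] := maxX Y.
    split=> [|YX]; last by apply: nX0; apply: YX; right.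
    by move=> x Xx; left.
  split=> [a x y [/noX//|->] [/noX//|->]|[//|/eqP]]; last by apply/negP.
  by right; rewrite scaler0 addr0.
have XZ a x : X x -> X (a *: x) by move=> Xx; rewrite -[_ *: _]addr0; apply: subX.
have XD x y : X x -> X y -> X (x + y).
  by move=> Xx Xy; rewrite -[x]scale1r; apply: subX.
have dec x : exists c : k, X (x - c *: u).
  have [Xx|nXx] := boolp.pselect (X x).
    by exists 0; rewrite scale0r subr0.
  pose Y y := exists b : k, X (y - b *: x).
  have XY y : X y -> Y y by move=> Xy; exists 0; rewrite scale0r subr0.
  have [[b Xb]|nYu] := boolp.pselect (Y u).
    have b0 : b != 0.
      by apply/eqP => b0; move: Xb; rewrite b0 scale0r subr0.
    exists b^-1; have := XZ (- b^-1) _ Xb.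
    by rewrite scalerBr scaleNr scaleNr opprK scalerA mulVf // scale1r addrC.
  have [] := maxX Y.
    split=> [|YX]; last by apply: nXx; apply: YX; exists 1; rewrite scale1r subrr.
    exact: XY.
  split=> // a y z [b Xb] [c Xc]; exists (a * b + c).
  have -> : a *: y + z - (a * b + c) *: x = a *: (y - b *: x) + (z - c *: x).
    by rewrite scalerBr scalerDl scalerA opprD addrACA.
  exact: subX.
have uniq a b x : X (x - a *: u) -> X (x - b *: u) -> a = b.
  move=> Xa Xb; apply/eqP; rewrite -subr_eq0; apply/negPn/negP => ab.
  apply: Xu; rewrite -[u]scale1r -(mulVf ab) -scalerA; apply: XZ.
  have -> : (a - b) *: u = (-1) *: (x - a *: u) + (x - b *: u).
    by rewrite scaleN1r opprB scalerBl addrA subrK.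
  exact: subX.
have [f fP] := boolp.choice dec.
exists f; last by apply: uniq (fP u) _; rewrite scale1r subrr.
move=> a x y; apply: uniq (fP _) _.
have -> : a *: x + y - (a * f x + f y) *: u =
    a *: (x - f x *: u) + (y - f y *: u).
  by rewrite scalerBr scalerDl scalerA opprD addrACA.
exact: subX.
Qed.

End TensorTheory.

Section TensorAlgebra.
Variables (k : fieldType) (A B : algType k).
Implicit Types (x y z : A ⊗ B).

Definition tensor_one : A ⊗ B := 1 ⊗ 1.

(* (a ⊗ b) (c ⊗ d) = (a c) ⊗ (b d), see [tens_mul] *)
Definition tensor_mul x y : A ⊗ B :=
  tlift (fun a b => tlift (fun c d => (a * c) ⊗ (b * d)) y) x.

Fact tensor_mul_bilinear1 a b : bilinear_for *:%R *:%R
  (fun (c : A) (d : B) => (a * c) ⊗ (b * d)).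
Proof.
by split=> [d r c c'|c r d d'] /=;
  rewrite mulrDr -scalerAr ?tensPl ?tensPr.
Qed.

Fact tensor_mul_bilinear2 y : bilinear_for *:%R *:%R
  (fun (a : A) (b : B) => tlift (fun c d => (a * c) ⊗ (b * d)) y).
Proof.
split=> [b r a a'|a r b b'] /=; rewrite -tliftP; apply: eq_tlift => c d;
  by rewrite mulrDl -scalerAl ?tensPl ?tensPr.
Qed.

Fact tensor_mul_bilinear : bilinear_for *:%R *:%R tensor_mul.
Proof.
split=> [y|x] /=; first exact: (tlift_linear (tensor_mul_bilinear2 y)).
move=> r y y'; rewrite /tensor_mul -tliftP; apply: eq_tlift => a b.
exact: (tlift_linear (tensor_mul_bilinear1 a b)).
Qed.

Fact tensor_mulE a b c d :
  tensor_mul (a ⊗ b) (c ⊗ d) = (a * c) ⊗ (b * d).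
Proof.
rewrite /tensor_mul (tlift_tens (tensor_mul_bilinear2 _)).
exact: (tlift_tens (tensor_mul_bilinear1 _ _)).
Qed.

Fact tensor_mulDl : left_distributive tensor_mul +%R.
Proof. by move=> x x' y; apply: (linearI (tensor_mul_bilinear.1 y)).1. Qed.

Fact tensor_mulDr : right_distributive tensor_mul +%R.
Proof. by move=> x; apply: (linearI (tensor_mul_bilinear.2 x)).1. Qed.

Fact tensor_mul0l y : tensor_mul 0 y = 0.
Proof. exact: (linearI (tensor_mul_bilinear.1 y)).2. Qed.

Fact tensor_mul0r x : tensor_mul x 0 = 0.
Proof. exact: (linearI (tensor_mul_bilinear.2 x)).2. Qed.

Fact tensor_mulA : associative tensor_mul.
Proof.
move=> x y z; elim/tensor_ind: x => [|a b|x x' Hx Hx'].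
- by rewrite !tensor_mul0l.
- elim/tensor_ind: y => [|c d|y y' Hy Hy'].
  + by rewrite tensor_mul0l tensor_mul0r tensor_mul0l.
  + elim/tensor_ind: z => [|e f|z z' Hz Hz'].
    * by rewrite !tensor_mul0r.
    * by rewrite !tensor_mulE !mulrA.
    * by rewrite !tensor_mulDr Hz Hz'.
  + by rewrite tensor_mulDl !tensor_mulDr tensor_mulDl Hy Hy'.
- by rewrite !tensor_mulDl Hx Hx'.
Qed.

Fact tensor_mul1l : left_id tensor_one tensor_mul.
Proof.
move=> x; elim/tensor_ind: x => [|a b|x x' Hx Hx'].
- exact: tensor_mul0r.
- by rewrite tensor_mulE !mul1r.
- by rewrite tensor_mulDr Hx Hx'.
Qed.

Fact tensor_mul1r : right_id tensor_one tensor_mul.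
Proof.
move=> x; elim/tensor_ind: x => [|a b|x x' Hx Hx'].
- exact: tensor_mul0l.
- by rewrite tensor_mulE !mulr1.
- by rewrite tensor_mulDl Hx Hx'.
Qed.

Fact tensor_one_neq0 : tensor_one != 0.
Proof.
have [f lf f1] := linear_separation (oner_neq0 A).
have bil : bilinear_for *:%R *:%R (fun (a : A) (b : B) => (f a : k) *: b).
  split=> [b r a a'|a r b b'] /=; first by rewrite lf scalerDl -scalerA.
  by rewrite scalerDr !scalerA mulrC.
apply/eqP => e; have := tlift_tens bil 1 1.
rewrite -/tensor_one e (linearI (tlift_linear bil)).2 f1 scale1r.
by move/esym/eqP; apply/negP/oner_neq0.
Qed.

HB.instance Definition _ := GRing.Zmodule_isNzRing.Build (A ⊗ B)%type
  tensor_mulA tensor_mul1l tensor_mul1r tensor_mulDl tensor_mulDr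
  tensor_one_neq0.

Fact tensor_scaleAl r x y : r *: (x * y) = (r *: x) * y.
Proof.
have := tensor_mul_bilinear.1 y r x 0.
by rewrite /= !addr0 tensor_mul0l addr0 => <-.
Qed.

Fact tensor_scaleAr r x y : r *: (x * y) = x * (r *: y).
Proof.
have := tensor_mul_bilinear.2 x r y 0.
by rewrite /= !addr0 tensor_mul0r addr0 => <-.
Qed.

HB.instance Definition _ := GRing.Lmodule_isLalgebra.Build k (A ⊗ B)%type
  tensor_scaleAl.
HB.instance Definition _ := GRing.Lalgebra_isAlgebra.Build k (A ⊗ B)%type
  tensor_scaleAr.

Lemma tens_mul (a c : A) (b d : B) : (a ⊗ b) * (c ⊗ d) = (a * c) ⊗ (b * d).
Proof. exact: tensor_mulE. Qed.

Lemma tens_one : 1 ⊗ 1 = 1 :> A ⊗ B.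
Proof. by []. Qed.

End TensorAlgebra.

Section TensorMaps.
Variables (k : fieldType).

Definition tmap (U U' V V' : lmodType k) (f : U -> U') (g : V -> V') :
    U ⊗ V -> U' ⊗ V' :=
  tlift (fun u v => f u ⊗ g v).

Definition tswap (U V : lmodType k) : U ⊗ V -> V ⊗ U :=
  tlift (fun u v => v ⊗ u).

Definition tassoc (U V W : lmodType k) : U ⊗ (V ⊗ W) -> U ⊗ V ⊗ W :=
  tlift (fun u x => tlift (fun v w => u ⊗ v ⊗ w) x).

Definition tlift3 (U V W X : lmodType k) (f : U -> V -> W -> X) :
    U ⊗ V ⊗ W -> X :=
  tlift (fun x w => tlift (fun u v => f u v w) x).

Definition lcontract (U V : lmodType k) (e : U -> k^o) : U ⊗ V -> V :=
  tlift (fun u v => (e u : k) *: v).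

Definition rcontract (U V : lmodType k) (e : V -> k^o) : U ⊗ V -> U :=
  tlift (fun u v => (e v : k) *: u).

End TensorMaps.

Section TensorMapsTheory.
Variables (k : fieldType).
Implicit Types (U V W X : lmodType k).

Fact tmap_bilinear U U' V V' (f : {linear U -> U'}) (g : {linear V -> V'}) :
  bilinear_for *:%R *:%R (fun u v => f u ⊗ g v).
Proof. by split=> [v a u u'|u a v v'] /=; rewrite linearP ?tensPl ?tensPr. Qed.

Lemma tmap_tens U U' V V' (f : {linear U -> U'}) (g : {linear V -> V'}) u v :
  tmap f g (u ⊗ v) = f u ⊗ g v.
Proof. exact: (tlift_tens (tmap_bilinear f g)). Qed.

HB.instance Definition _ U U' V V' (f : {linear U -> U'})
    (g : {linear V -> V'}) :=
  GRing.isLinear.Build k (U ⊗ V)%type (U' ⊗ V')%type *:%R (tmap f g)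
    (tlift_linear (tmap_bilinear f g)).

Fact tswap_bilinear U V : bilinear_for *:%R *:%R (fun (u : U) (v : V) => v ⊗ u).
Proof. by split=> [v a u u'|u a v v'] /=; rewrite ?tensPl ?tensPr. Qed.

Lemma tswap_tens U V (u : U) (v : V) : tswap (u ⊗ v) = v ⊗ u.
Proof. exact: (tlift_tens (tswap_bilinear U V)). Qed.

HB.instance Definition _ U V :=
  GRing.isLinear.Build k (U ⊗ V)%type (V ⊗ U)%type *:%R (@tswap k U V)
    (tlift_linear (tswap_bilinear U V)).

Fact tassoc_bilinear1 U V W (u : U) :
  bilinear_for *:%R *:%R (fun (v : V) (w : W) => u ⊗ v ⊗ w).
Proof. by split=> [w a v v'|v a w w'] /=; rewrite ?tensPr ?tensPl. Qed.

Fact tassoc_bilinear U V W : bilinear_for *:%R *:%R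
  (fun (u : U) (x : V ⊗ W) => tlift (fun v w => u ⊗ v ⊗ w) x).
Proof.
split=> [x a u u'|u a x x'] /=.
  by rewrite -tliftP; apply: eq_tlift => v w; rewrite !tensPl.
exact: (tlift_linear (tassoc_bilinear1 V W u)).
Qed.

Lemma tassoc_tens U V W (u : U) (v : V) (w : W) :
  tassoc (u ⊗ (v ⊗ w)) = u ⊗ v ⊗ w.
Proof.
rewrite /tassoc (tlift_tens (tassoc_bilinear _ _ _)).
exact: (tlift_tens (tassoc_bilinear1 _ _ _)).
Qed.

HB.instance Definition _ U V W :=
  GRing.isLinear.Build k (U ⊗ (V ⊗ W))%type (U ⊗ V ⊗ W)%type *:%R
    (@tassoc k U V W) (tlift_linear (tassoc_bilinear U V W)).

Definition trilinear U V W X (f : U -> V -> W -> X) : Prop :=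
  [/\ forall v w, linear (fun u => f u v w), forall u w, linear (fun v => f u v w)
    & forall u v, linear (f u v)].

Fact tlift3_bilinear1 U V W X (f : U -> V -> W -> X) w :
  trilinear f -> bilinear_for *:%R *:%R (fun u v => f u v w).
Proof. by case=> f1 f2 _; split. Qed.

Fact tlift3_bilinear U V W X (f : U -> V -> W -> X) : trilinear f ->
  bilinear_for *:%R *:%R (fun x w => tlift (fun u v => f u v w) x).
Proof.
move=> trif; split=> [w|x a w w'] /=.
  exact: (tlift_linear (tlift3_bilinear1 w trif)).
by case: trif => _ _ f3; rewrite -tliftP; apply: eq_tlift => u v; rewrite f3.
Qed.

Lemma tlift3_tens U V W X (f : U -> V -> W -> X) u v w :
  trilinear f -> tlift3 f (u ⊗ v ⊗ w) = f u v w.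
Proof.
move=> trif; rewrite /tlift3 (tlift_tens (tlift3_bilinear trif)).
exact: (tlift_tens (tlift3_bilinear1 w trif)).
Qed.

Lemma tlift3_linear U V W X (f : U -> V -> W -> X) :
  trilinear f -> linear (tlift3 f).
Proof. by move=> /tlift3_bilinear/tlift_linear. Qed.

Lemma lcontract_tens U V (e : {linear U -> k^o}) u (v : V) :
  lcontract e (u ⊗ v) = (e u : k) *: v.
Proof.
rewrite /lcontract tlift_tens //; split=> [{}v a x x'|x a w w'] /=.
  by rewrite linearP scalerDl -scalerA.
by rewrite scalerDr !scalerA mulrC.
Qed.

Lemma rcontract_tens U V (e : {linear V -> k^o}) (u : U) v :
  rcontract e (u ⊗ v) = (e v : k) *: u.
Proof.
rewrite /rcontract tlift_tens //; split=> [x a w w'|{}u a x x'] /=.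
  by rewrite scalerDr !scalerA mulrC.
by rewrite linearP scalerDl -scalerA.
Qed.

Lemma tensor_monoid_morphism (A B C : algType k)
    (f : {linear (A ⊗ B)%type -> C}) :
  f 1 = 1 ->
  (forall a a' b b',
     f ((a * a') ⊗ (b * b')) = f (a ⊗ b) * f (a' ⊗ b')) ->
  monoid_morphism f.
Proof.
move=> f1 fM; split=> // x y; elim/tensor_ind: x => [|a b|x x' Hx Hx'].
- by rewrite mul0r linear0 mul0r.
- elim/tensor_ind: y => [|a' b'|y y' Hy Hy'].
  + by rewrite mulr0 linear0 mulr0.
  + by rewrite tens_mul fM.
  + by rewrite mulrDr !linearD mulrDr Hy Hy'.
- by rewrite mulrDl !linearD mulrDl Hx Hx'.
Qed.

Section AlgebraMaps.
Variables (A A' B B' : algType k).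

Fact tmap_monoid_morphism (f : {lrmorphism A -> A'}) (g : {lrmorphism B -> B'}) :
  monoid_morphism (tmap f g).
Proof.
pose h : {linear (A ⊗ B)%type -> (A' ⊗ B')%type} := tmap f g.
apply: (tensor_monoid_morphism (f := h)) => [|a a' b b'] /=.
  by rewrite -tens_one tmap_tens !rmorph1.
by rewrite !tmap_tens !rmorphM tens_mul.
Qed.

HB.instance Definition _ (f : {lrmorphism A -> A'}) (g : {lrmorphism B -> B'}) :=
  GRing.isMonoidMorphism.Build (A ⊗ B)%type (A' ⊗ B')%type (tmap f g)
    (tmap_monoid_morphism f g).

End AlgebraMaps.

Lemma tensor3_monoid_morphism (A B C D : algType k)
    (f : {linear (A ⊗ B ⊗ C)%type -> D}) :
  f 1 = 1 ->
  (forall a a' b b' c c', f ((a * a') ⊗ (b * b') ⊗ (c * c')) =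
     f (a ⊗ b ⊗ c) * f (a' ⊗ b' ⊗ c')) ->
  monoid_morphism f.
Proof.
move=> f1 fM; apply: tensor_monoid_morphism => // x y c c'.
elim/tensor_ind: x => [|a b|x x' Hx Hx'].
- by rewrite mul0r !tens0l !linear0 mul0r.
- elim/tensor_ind: y => [|a' b'|y y' Hy Hy'].
  + by rewrite mulr0 !tens0l !linear0 mulr0.
  + by rewrite tens_mul fM.
  + by rewrite mulrDr !tensDl !linearD mulrDr Hy Hy'.
- by rewrite mulrDl !tensDl !linearD mulrDl Hx Hx'.
Qed.

End TensorMapsTheory.

(** [perm_ijk] sends Phi^1 ⊗ Phi^2 ⊗ Phi^3 to Phi^i ⊗ Phi^j ⊗ Phi^k.  It is an
    algebra morphism, so the inverse of Phi_ijk is [perm_ijk] of the inverse of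
    Phi. *)
Section Legs.
Variables (k : fieldType) (H : algType k).

Definition leg12 (x : H ⊗ H) : H ⊗ H ⊗ H := x ⊗ 1.
Definition leg23 (x : H ⊗ H) : H ⊗ H ⊗ H := tassoc (1 ⊗ x).
Definition leg13 (x : H ⊗ H) : H ⊗ H ⊗ H := tlift (fun a b => a ⊗ 1 ⊗ b) x.

Definition leg123 (x : H ⊗ H ⊗ H) : H ⊗ H ⊗ H ⊗ H := x ⊗ 1.
Definition leg234 (x : H ⊗ H ⊗ H) : H ⊗ H ⊗ H ⊗ H :=
  tmap (@tassoc _ _ _ _) idfun (tassoc (1 ⊗ x)).

Definition perm213 : H ⊗ H ⊗ H -> H ⊗ H ⊗ H := tlift3 (fun a b c => b ⊗ a ⊗ c).
Definition perm132 : H ⊗ H ⊗ H -> H ⊗ H ⊗ H := tlift3 (fun a b c => a ⊗ c ⊗ b).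
Definition perm231 : H ⊗ H ⊗ H -> H ⊗ H ⊗ H := tlift3 (fun a b c => b ⊗ c ⊗ a).
Definition perm312 : H ⊗ H ⊗ H -> H ⊗ H ⊗ H := tlift3 (fun a b c => c ⊗ a ⊗ b).

Lemma leg23_tens a b : leg23 (a ⊗ b) = 1 ⊗ a ⊗ b.
Proof. exact: tassoc_tens. Qed.

Fact leg13_bilinear :
  bilinear_for *:%R *:%R (fun a b : H => a ⊗ (1 : H) ⊗ b).
Proof. by split=> x a y z /=; rewrite ?(tensPl, tensPr). Qed.

Lemma leg13_tens a b : leg13 (a ⊗ b) = a ⊗ 1 ⊗ b.
Proof. exact: (tlift_tens leg13_bilinear). Qed.

Lemma leg234_tens a b c : leg234 (a ⊗ b ⊗ c) = 1 ⊗ a ⊗ b ⊗ c.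
Proof. by rewrite /leg234 tassoc_tens tmap_tens /= tassoc_tens. Qed.

Fact perm213_trilinear : trilinear (fun a b c : H => b ⊗ a ⊗ c).
Proof. by split=> x y a z z' /=; rewrite ?(tensPl, tensPr). Qed.
Fact perm132_trilinear : trilinear (fun a b c : H => a ⊗ c ⊗ b).
Proof. by split=> x y a z z' /=; rewrite ?(tensPl, tensPr). Qed.
Fact perm231_trilinear : trilinear (fun a b c : H => b ⊗ c ⊗ a).
Proof. by split=> x y a z z' /=; rewrite ?(tensPl, tensPr). Qed.
Fact perm312_trilinear : trilinear (fun a b c : H => c ⊗ a ⊗ b).
Proof. by split=> x y a z z' /=; rewrite ?(tensPl, tensPr). Qed.

Lemma perm213_tens a b c : perm213 (a ⊗ b ⊗ c) = b ⊗ a ⊗ c.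
Proof. exact: (tlift3_tens _ _ _ perm213_trilinear). Qed.
Lemma perm132_tens a b c : perm132 (a ⊗ b ⊗ c) = a ⊗ c ⊗ b.
Proof. exact: (tlift3_tens _ _ _ perm132_trilinear). Qed.
Lemma perm231_tens a b c : perm231 (a ⊗ b ⊗ c) = b ⊗ c ⊗ a.
Proof. exact: (tlift3_tens _ _ _ perm231_trilinear). Qed.
Lemma perm312_tens a b c : perm312 (a ⊗ b ⊗ c) = c ⊗ a ⊗ b.
Proof. exact: (tlift3_tens _ _ _ perm312_trilinear). Qed.

Local Notation H3 := (H ⊗ H ⊗ H)%type.

HB.instance Definition _ := GRing.isLinear.Build k H3 H3 *:%R perm213
  (tlift3_linear perm213_trilinear).
HB.instance Definition _ := GRing.isLinear.Build k H3 H3 *:%R perm132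
  (tlift3_linear perm132_trilinear).
HB.instance Definition _ := GRing.isLinear.Build k H3 H3 *:%R perm231
  (tlift3_linear perm231_trilinear).
HB.instance Definition _ := GRing.isLinear.Build k H3 H3 *:%R perm312
  (tlift3_linear perm312_trilinear).

Fact perm213_monoid_morphism : monoid_morphism perm213.
Proof.
apply: (tensor3_monoid_morphism (f := perm213)) => [|a a' b b' c c'] /=.
  exact: (perm213_tens 1 1 1).
by rewrite !perm213_tens !tens_mul.
Qed.
Fact perm132_monoid_morphism : monoid_morphism perm132.
Proof.
apply: (tensor3_monoid_morphism (f := perm132)) => [|a a' b b' c c'] /=.
  exact: (perm132_tens 1 1 1).
by rewrite !perm132_tens !tens_mul.
Qed.
Fact perm231_monoid_morphism : monoid_morphism perm231.
Proof.
apply: (tensor3_monoid_morphism (f := perm231)) => [|a a' b b' c c'] /=.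
  exact: (perm231_tens 1 1 1).
by rewrite !perm231_tens !tens_mul.
Qed.
Fact perm312_monoid_morphism : monoid_morphism perm312.
Proof.
apply: (tensor3_monoid_morphism (f := perm312)) => [|a a' b b' c c'] /=.
  exact: (perm312_tens 1 1 1).
by rewrite !perm312_tens !tens_mul.
Qed.

HB.instance Definition _ := GRing.isMonoidMorphism.Build H3 H3 perm213
  perm213_monoid_morphism.
HB.instance Definition _ := GRing.isMonoidMorphism.Build H3 H3 perm132
  perm132_monoid_morphism.
HB.instance Definition _ := GRing.isMonoidMorphism.Build H3 H3 perm231
  perm231_monoid_morphism.
HB.instance Definition _ := GRing.isMonoidMorphism.Build H3 H3 perm312
  perm312_monoid_morphism.

End Legs.

(** Invertible elements are given together with their (unique) inverse. *)

Definition mutually_inverse (A : pzRingType) (x y : A) : Prop :=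
  x * y = 1 /\ y * x = 1.

(* id ⊗ D, rebracketed: A ⊗ B ⊗ C stands for (A ⊗ B) ⊗ C throughout. *)
Definition id_tmap (k : fieldType) (A H : algType k) (D : H -> H ⊗ H) :
    A ⊗ H -> A ⊗ H ⊗ H :=
  fun x => tassoc (tmap idfun D x).

Record quasi_bialgebra (k : fieldType) (H : algType k) := QuasiBialgebra {
  Delta : {lrmorphism H -> (H ⊗ H)%type};
  eps : {lrmorphism H -> k^o};
  Phi : H ⊗ H ⊗ H;
  Phi_inv : H ⊗ H ⊗ H;
  lunit : H;
  lunit_inv : H;
  runit : H;
  runit_inv : H;
  Phi_invertible : mutually_inverse Phi Phi_inv;
  lunit_invertible : mutually_inverse lunit lunit_inv;
  runit_invertible : mutually_inverse runit runit_inv;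
  quasi_coassociativity : forall h,
    id_tmap Delta (Delta h) = Phi * tmap Delta idfun (Delta h) * Phi_inv;
  left_counit : forall h, lcontract eps (Delta h) = lunit_inv * h * lunit;
  right_counit : forall h, rcontract eps (Delta h) = runit_inv * h * runit;
  pentagon :
    id_tmap Delta Phi * tmap (tmap Delta idfun) idfun Phi
      = leg234 Phi * tmap (id_tmap Delta) idfun Phi * leg123 Phi;
  triangle : tmap (rcontract eps) idfun Phi = runit ⊗ lunit_inv
}.

Record quasitriangular_quasi_bialgebra (k : fieldType) (H : algType k) :=
    QuasitriangularQuasiBialgebra {
  qt_base :> quasi_bialgebra H;
  Rmat : H ⊗ H;
  Rmat_inv : H ⊗ H;
  Rmat_invertible : mutually_inverse Rmat Rmat_inv;
  quasi_cocommutativity : forall h,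
    tswap (Delta qt_base h) = Rmat * Delta qt_base h * Rmat_inv;
  hexagon_id_Delta :
    id_tmap (Delta qt_base) Rmat
      = perm312 (Phi_inv qt_base) * leg13 Rmat * perm213 (Phi qt_base)
        * leg12 Rmat * Phi_inv qt_base;
  hexagon_Delta_id :
    tmap (Delta qt_base) idfun Rmat
      = perm231 (Phi qt_base) * leg13 Rmat * perm132 (Phi_inv qt_base)
        * leg23 Rmat * Phi qt_base
}.

Record pre_cartier_quasi_bialgebra (k : fieldType) (H : algType k) :=
    PreCartierQuasiBialgebra {
  pc_base :> quasitriangular_quasi_bialgebra H;
  chi : H ⊗ H;
  chi_central : forall h,
    chi * Delta pc_base h = Delta pc_base h * chi;
  chi_id_Delta :
    id_tmap (Delta pc_base) chi
      = Phi pc_base * leg12 (Rmat_inv pc_base) * perm213 (Phi_inv pc_base)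
          * leg13 chi
          * perm213 (Phi pc_base) * leg12 (Rmat pc_base) * Phi_inv pc_base
        + Phi pc_base * leg12 chi * Phi_inv pc_base;
  chi_Delta_id :
    tmap (Delta pc_base) idfun chi
      = Phi_inv pc_base * leg23 (Rmat_inv pc_base) * perm132 (Phi pc_base)
          * leg13 chi
          * perm132 (Phi_inv pc_base) * leg23 (Rmat pc_base) * Phi pc_base
        + Phi_inv pc_base * leg23 chi * Phi pc_base
}.

Definition commutator (A : pzRingType) (x y : A) : A := x * y - y * x.

(* The indices 1, 2, 3 are the elements 0, 1, 2 of 'I_3; the diagonal values are
   irrelevant. *)
Definition symmetric_family (A : zmodType) (a12 a13 a23 : A) (i j : 'I_3) : A :=
  match minn i j, maxn i j with
  | 0%N, 1%N => a12
  | 0%N, 2%N => a13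
  | 1%N, 2%N => a23
  | _, _ => 0
  end.

Definition infinitesimal_braid_relations (A : pzRingType)
    (a : 'I_3 -> 'I_3 -> A) : Prop :=
  forall i j l : 'I_3, [set i; j; l] = [set: 'I_3] ->
    commutator (a i j) (a i l + a j l) = 0.

Section PreCartierElements.
Variables (k : fieldType) (H : algType k) (Q : pre_cartier_quasi_bialgebra H).

Local Notation Φ := (Phi Q).
Local Notation Φi := (Phi_inv Q).
Local Notation R := (Rmat Q).
Local Notation Ri := (Rmat_inv Q).

Definition Theta12 : H ⊗ H ⊗ H := leg12 (chi Q).
Definition Theta23 : H ⊗ H ⊗ H := Φi * leg23 (chi Q) * Φ.
Definition Theta13 : H ⊗ H ⊗ H :=
  Φi * leg23 Ri * perm132 Φ * leg13 (chi Q) * perm132 Φi * leg23 R * Φ.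

Definition Upsilon12 : H ⊗ H ⊗ H := Φ * leg12 (chi Q) * Φi.
Definition Upsilon23 : H ⊗ H ⊗ H := leg23 (chi Q).
Definition Upsilon13 : H ⊗ H ⊗ H :=
  Φ * leg12 Ri * perm213 Φi * leg13 (chi Q) * perm213 Φ * leg12 R * Φi.

Definition Theta : 'I_3 -> 'I_3 -> H ⊗ H ⊗ H :=
  symmetric_family Theta12 Theta13 Theta23.
Definition Upsilon : 'I_3 -> 'I_3 -> H ⊗ H ⊗ H :=
  symmetric_family Upsilon12 Upsilon13 Upsilon23.

End PreCartierElements.

(* Main.v *)
Require Import Defs.
From HB Require Import structures.
From mathcomp Require Import all_boot all_order all_algebra.

Set Implicit Arguments.
Unset Strict Implicit.
Unset Printing Implicit Defensive.

(** Naturality of the infinitesimal braiding gives one braid relation for each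
    family at once: (Δ ⊗ id)(χ) = Θ13 + Θ23 commutes with χ_12 = Θ12 because χ
    commutes with the image of Δ ([leg12_chi_comm]), and likewise
    (id ⊗ Δ)(χ) = Υ13 + Υ12 commutes with χ_23 = Υ23 ([leg23_chi_comm]).

    The two families turn out to be conjugate, Υ = Φ Θ Φ^-1, so each of these
    relations holds for both families.  Conjugacy is clear for the indices 12
    and 23; for 13 it is the equality Θ13 = Φ^-1 Υ13 Φ ([Theta13E]).  To see it,
    flip the first two legs of (Δ ⊗ id)(χ) = Θ13 + Θ23.  Since R intertwines Δ
    and Δ^op, this flip is conjugation by R_12; undoing the conjugation turns
    the flip of Θ23 into Φ^-1 Υ13 Φ, and the flip of Θ13 into the conjugate of
    χ_23 by Φ_312^-1 R_13 Φ_213 R_12.  The hexagon identifies this last element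
    with (id ⊗ Δ)(R) Φ, and χ_23 commutes with (id ⊗ Δ)(R), so what is left is
    Φ^-1 χ_23 Φ = Θ23.  Hence Θ13 + Θ23 = Φ^-1 Υ13 Φ + Θ23.

    Finally, A12 and A23 both commute with the sum A12 + A13 + A23, hence so
    does A13: this is the third relation ([braid_relations_from_two]). *)

Import GRing.Theory.
Local Open Scope ring_scope.

(** * Commutators, conjugation and the braid relations *)

Section Rings.
Variable A : pzRingType.
Implicit Types x y z u v : A.

Lemma commutator_eq0 x y : commutator x y = 0 <-> GRing.comm x y.
Proof. by rewrite /commutator; split=> [/subr0_eq|->]; rewrite ?subrr. Qed.

Lemma comm_conj u v x y :
  v * u = 1 -> GRing.comm x y -> GRing.comm (u * x * v) (u * y * v).
Proof.
move=> vu xy.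
have conjM a b : u * a * v * (u * b * v) = u * (a * b) * v.
  by rewrite !mulrA -(mulrA _ v u) vu mulr1.
by rewrite /GRing.comm !conjM xy.
Qed.

Lemma braid_relations_symmetric (a12 a13 a23 : A) :
    GRing.comm a12 (a13 + a23) -> GRing.comm a13 (a12 + a23) ->
    GRing.comm a23 (a12 + a13) ->
  infinitesimal_braid_relations (symmetric_family a12 a13 a23).
Proof.
move=> c12 c13 c23 i j l ijl; apply/commutator_eq0.
(* A triple with a repeated index misses one of 0, 1, 2; six triples remain. *)
have mem_ijl m : m \in [set i; j; l] by rewrite ijl in_setT.
move: {ijl mem_ijl} (mem_ijl ord0) (mem_ijl (inord 1)) (mem_ijl (inord 2)).
rewrite !inE -!val_eqE /= !inordK //.
case: i => [[|[|[|//]]] ?]; case: j => [[|[|[|//]]] ?];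
  case: l => [[|[|[|//]]] ?] //= _ _ _; rewrite /symmetric_family //=.
all: by rewrite // addrC.
Qed.

(** The sum of the three elements commutes with two of them, hence with the
    third. *)
Lemma braid_relations_from_two (a12 a13 a23 : A) :
    GRing.comm a12 (a13 + a23) -> GRing.comm a23 (a12 + a13) ->
  infinitesimal_braid_relations (symmetric_family a12 a13 a23).
Proof.
move=> c12 c23; apply: braid_relations_symmetric => //.
pose s := a12 + a13 + a23.
have s12 : GRing.comm s a12.
  by apply: commr_sym; rewrite /s -addrA; apply: commrD.
have s23 : GRing.comm s a23 by apply: commr_sym; apply: commrD.
have -> : a12 + a23 = s - a13 by rewrite /s addrAC addrK.
apply: commrB => //.
have -> : a13 = s - a23 - a12 by rewrite /s addrK addrAC subrr add0r.
by apply: commr_sym; apply: commrB => //; apply: commrB.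
Qed.

End Rings.

Lemma symmetric_family_map (A B : zmodType) (f : A -> B) a12 a13 a23 i j :
  f 0 = 0 ->
  f (symmetric_family a12 a13 a23 i j) =
    symmetric_family (f a12) (f a13) (f a23) i j.
Proof.
move=> f0; rewrite /symmetric_family.
by case: (minn i j) (maxn i j) => [|[|n]] [|[|[|m]]].
Qed.

(** * Leg embeddings as algebra maps *)

Section LegMaps.
Variables (k : fieldType) (H : algType k).
Implicit Types x y : (H ⊗ H)%type.

Lemma tassoc_mul (a b : H) (x y : H ⊗ H) :
  tassoc (a ⊗ x) * tassoc (b ⊗ y) = tassoc ((a * b) ⊗ (x * y)).
Proof.
elim/tensor_ind: x => [|c d|x x' Hx Hx'].
- by rewrite mul0r !tens0r !linear0 mul0r.
- elim/tensor_ind: y => [|e f|y y' Hy Hy'].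
  + by rewrite mulr0 !tens0r !linear0 mulr0.
  + by rewrite !tens_mul !tassoc_tens !tens_mul.
  + by rewrite mulrDr !tensDr !linearD mulrDr Hy Hy'.
- by rewrite mulrDl !tensDr !linearD mulrDl Hx Hx'.
Qed.

Fact leg12_linear : linear (@leg12 k H).
Proof. by move=> a x y; apply: tensPl. Qed.

HB.instance Definition _ :=
  GRing.isLinear.Build k (H ⊗ H)%type (H ⊗ H ⊗ H)%type *:%R (@leg12 k H)
    leg12_linear.

Fact leg12_monoid_morphism : monoid_morphism (@leg12 k H).
Proof. by split=> // x y; rewrite /leg12 tens_mul mulr1. Qed.

HB.instance Definition _ :=
  GRing.isMonoidMorphism.Build (H ⊗ H)%type (H ⊗ H ⊗ H)%type (@leg12 k H)
    leg12_monoid_morphism.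

Fact leg23_linear : linear (@leg23 k H).
Proof. by move=> a x y; rewrite /leg23 tensPr linearP. Qed.

HB.instance Definition _ :=
  GRing.isLinear.Build k (H ⊗ H)%type (H ⊗ H ⊗ H)%type *:%R (@leg23 k H)
    leg23_linear.

Fact leg23_monoid_morphism : monoid_morphism (@leg23 k H).
Proof.
apply: (tensor_monoid_morphism (f := @leg23 k H)) => [|a a' b b'] /=.
  by rewrite -tens_one leg23_tens.
by rewrite !leg23_tens !tens_mul mulr1.
Qed.

HB.instance Definition _ :=
  GRing.isMonoidMorphism.Build (H ⊗ H)%type (H ⊗ H ⊗ H)%type (@leg23 k H)
    leg23_monoid_morphism.

HB.instance Definition _ :=
  GRing.isLinear.Build k (H ⊗ H)%type (H ⊗ H ⊗ H)%type *:%R (@leg13 k H)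
    (tlift_linear (@leg13_bilinear k H)).

Fact leg13_monoid_morphism : monoid_morphism (@leg13 k H).
Proof.
apply: (tensor_monoid_morphism (f := @leg13 k H)) => [|a a' b b'] /=.
  by rewrite -tens_one leg13_tens.
by rewrite !leg13_tens !tens_mul mulr1.
Qed.

HB.instance Definition _ :=
  GRing.isMonoidMorphism.Build (H ⊗ H)%type (H ⊗ H ⊗ H)%type (@leg13 k H)
    leg13_monoid_morphism.

Lemma perm213_leg23 x : perm213 (leg23 x) = leg13 x.
Proof.
elim/tensor_ind: x => [|a b|x y Hx Hy]; first by rewrite !linear0.
  by rewrite leg23_tens perm213_tens leg13_tens.
by rewrite !linearD /= Hx Hy.
Qed.

Lemma perm213_leg13 x : perm213 (leg13 x) = leg23 x.
Proof.
elim/tensor_ind: x => [|a b|x y Hx Hy]; first by rewrite !linear0.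
  by rewrite leg23_tens leg13_tens perm213_tens.
by rewrite !linearD /= Hx Hy.
Qed.

Lemma tensor3_ext (W : lmodType k) (f g : {linear (H ⊗ H ⊗ H)%type -> W}) :
  (forall a b c, f (a ⊗ b ⊗ c) = g (a ⊗ b ⊗ c)) -> f =1 g.
Proof.
move=> fg x; elim/tensor_ind: x => [|x c|x y Hx Hy]; first by rewrite !linear0.
  elim/tensor_ind: x => [|a b|x y Hx Hy] //; first by rewrite tens0l !linear0.
  by rewrite tensDl !linearD /= Hx Hy.
by rewrite !linearD /= Hx Hy.
Qed.

Lemma perm213_perm132 (x : H ⊗ H ⊗ H) : perm213 (perm132 x) = perm312 x.
Proof.
apply: (tensor3_ext (f := @perm213 k H \o @perm132 k H)) x => a b c /=.
by rewrite perm132_tens perm213_tens perm312_tens.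
Qed.

Lemma perm213_tens12 (y : H ⊗ H) (b : H) : perm213 (y ⊗ b) = tswap y ⊗ b.
Proof.
elim/tensor_ind: y => [|a c|x y Hx Hy]; first by rewrite tens0l !linear0 tens0l.
  by rewrite perm213_tens tswap_tens.
by rewrite tensDl !linearD /= Hx Hy tensDl.
Qed.

End LegMaps.

(** * Quasitriangular and pre-Cartier structures *)

Section PreCartier.
Variables (k : fieldType) (H : algType k) (Q : pre_cartier_quasi_bialgebra H).

Local Notation D := (Delta Q).
Local Notation Φ := (Phi Q).
Local Notation Φi := (Phi_inv Q).
Local Notation R := (Rmat Q).
Local Notation Ri := (Rmat_inv Q).
Local Notation χ := (chi Q).

(** χ_12 meets only the first two legs of (Δ ⊗ id)(x), where it commutes with the
    image of Δ. *)
Lemma leg12_chi_comm (x : H ⊗ H) : GRing.comm (leg12 χ) (tmap D idfun x).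
Proof.
elim/tensor_ind: x => [|a b|x y Hx Hy].
- by rewrite linear0; apply: commr0.
- by rewrite tmap_tens /GRing.comm !tens_mul chi_central mul1r mulr1.
- by rewrite linearD; apply: commrD.
Qed.

(** Applied both to x = χ, for a braid relation, and to x = R, in the comparison
    of Θ13 with Υ13. *)
Lemma leg23_chi_comm (x : H ⊗ H) : GRing.comm (leg23 χ) (id_tmap D x).
Proof.
rewrite /id_tmap; elim/tensor_ind: x => [|a b|x y Hx Hy].
- by rewrite !linear0; apply: commr0.
- by rewrite tmap_tens /GRing.comm !tassoc_mul chi_central mul1r mulr1.
- by rewrite !linearD; apply: commrD.
Qed.

(** The flip of the first two legs turns Δ ⊗ id into Δ^op ⊗ id, and R intertwines
    Δ with Δ^op. *)
Lemma perm213_Delta_id (x : H ⊗ H) :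
  perm213 (tmap D idfun x) = leg12 R * tmap D idfun x * leg12 Ri.
Proof.
elim/tensor_ind: x => [|a b|x y Hx Hy].
- by rewrite !linear0 mulr0 mul0r.
- by rewrite tmap_tens perm213_tens12 quasi_cocommutativity !tens_mul mul1r mulr1.
- by rewrite !linearD /= Hx Hy mulrDr mulrDl.
Qed.

Lemma PhiVK : Φi * Φ = 1. Proof. by case: (Phi_invertible Q). Qed.
Lemma PhiK : Φ * Φi = 1. Proof. by case: (Phi_invertible Q). Qed.
Lemma RmatVK : Ri * R = 1. Proof. by case: (Rmat_invertible Q). Qed.

Lemma Delta_id_chi : tmap D idfun χ = Theta13 Q + Theta23 Q.
Proof. exact: chi_Delta_id. Qed.

Lemma id_Delta_chi : id_tmap D χ = Upsilon13 Q + Upsilon12 Q.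
Proof. exact: chi_id_Delta. Qed.

Let G := perm312 Φi * leg13 R * perm213 Φ * leg12 R.
Let Gi := leg12 Ri * perm213 Φi * leg13 Ri * perm312 Φ.

Let GVK : Gi * G = 1.
Proof.
rewrite /Gi /G !mulrA.
rewrite -(mulrA _ (perm312 Φ)) -rmorphM PhiK rmorph1 mulr1.
rewrite -(mulrA _ (leg13 Ri)) -rmorphM RmatVK rmorph1 mulr1.
rewrite -(mulrA _ (perm213 Φi)) -rmorphM PhiVK rmorph1 mulr1.
by rewrite -rmorphM RmatVK rmorph1.
Qed.

(** By the hexagon G = (id ⊗ Δ)(R) Φ, and the first factor commutes with
    χ_23. *)
Let conj_G_chi : Gi * leg23 χ * G = Theta23 Q.
Proof.
have GE : G = id_tmap D R * Φ by rewrite hexagon_id_Delta -mulrA PhiVK mulr1.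
have chiG : leg23 χ * G = G * Theta23 Q.
  by rewrite /Theta23 GE !mulrA leg23_chi_comm -(mulrA _ Φ) PhiK mulr1 -!mulrA.
by rewrite -mulrA chiG mulrA GVK mul1r.
Qed.

(** Compare (Δ ⊗ id)(χ) with its image under the flip of the first two legs,
    conjugated back by R_12. *)
Lemma Theta13E : Theta13 Q = Φi * Upsilon13 Q * Φ.
Proof.
apply: (addIr (Theta23 Q)); rewrite -Delta_id_chi.
have -> : tmap D idfun χ = leg12 Ri * perm213 (tmap D idfun χ) * leg12 R.
  rewrite perm213_Delta_id !mulrA -rmorphM RmatVK rmorph1 mul1r.
  by rewrite -mulrA -rmorphM RmatVK rmorph1 mulr1.
rewrite Delta_id_chi linearD mulrDr mulrDl addrC; congr (_ + _).
  rewrite /Theta23 /Upsilon13 !rmorphM /= perm213_leg23 !mulrA.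
  by rewrite PhiVK mul1r -[RHS]mulrA PhiVK mulr1.
rewrite /Theta13 !rmorphM /= !perm213_perm132 !perm213_leg23 perm213_leg13.
by rewrite -conj_G_chi /G /Gi !mulrA.
Qed.

(** Conjugation preserves commutators, so this lets relations pass between the
    two families. *)
Lemma UpsilonE i j : Upsilon Q i j = Φ * Theta Q i j * Φi.
Proof.
rewrite /Theta (symmetric_family_map (f := fun x => Φ * x * Φi));
  last by rewrite mulr0 mul0r.
have conjK x : Φ * (Φi * x * Φ) * Φi = x.
  by rewrite !mulrA PhiK mul1r -mulrA PhiK mulr1.
by rewrite Theta13E /Theta23 !conjK.
Qed.

Lemma Theta_braid_relations : infinitesimal_braid_relations (Theta Q).
Proof.
apply: braid_relations_from_two.
  by rewrite -Delta_id_chi; apply: leg12_chi_comm.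
have c23 : GRing.comm (Upsilon23 Q) (Upsilon13 Q + Upsilon12 Q).
  by rewrite -id_Delta_chi; apply: leg23_chi_comm.
(* Conjugation by Φ^-1 carries this relation for Υ to the one for Θ. *)
have := comm_conj PhiK c23; rewrite mulrDr mulrDl -Theta13E.
have -> : Φi * Upsilon12 Q * Φ = Theta12 Q.
  by rewrite /Upsilon12 !mulrA PhiVK mul1r -mulrA PhiVK mulr1.
by rewrite addrC.
Qed.

Lemma Upsilon_braid_relations : infinitesimal_braid_relations (Upsilon Q).
Proof.
move=> i j l ijl; apply/commutator_eq0; rewrite !UpsilonE -mulrDl -mulrDr.
by apply: comm_conj PhiVK _; apply/commutator_eq0/Theta_braid_relations.
Qed.

End PreCartier.

Theorem theorem3p17 (k : fieldType) (char_k0 : [pchar k]%R =i pred0)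
    (H : algType k) (Q : pre_cartier_quasi_bialgebra H) :
  infinitesimal_braid_relations (Theta Q) /\
  infinitesimal_braid_relations (Upsilon Q).
Proof.
by split; [apply: Theta_braid_relations | apply: Upsilon_braid_relations].
Qed.
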